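(* For all $\lambda\in\mathbb{Q}\setminus\{0,-1\}$ and all integers $n>1$ with $\gcd(n,2N_\lambda)=1$, we have $$a_\lambda(n)\notin\{\pm1,\pm3,5,-7,-15,\pm17,\pm19,21,-23,-27,-29,\pm31,33,37,-39,-51,57,69,-87\}.$$ Assuming the Generalized Riemann Hypothesis, we also have $$a_\lambda(n)\notin\{-41,\pm43,-47,-53,-59,\pm67,\pm71,79,-83,-89,\pm97\}.$$
   Context: For $\lambda\in\mathbb{Q}\setminus\{0,-1\}$ let $E_\lambda/\mathbb{Q}$ be the elliptic curve $y^2=(x-1)\left(x^2-\frac{1}{\lambda+1}\right)$, with conductor $N_\lambda$. For primes $p\nmid 2N_\lambda$ put $b_\lambda(p)=p+1-\#E_\lambda(\mathbb{F}_p)$. Define $$\sum_{n\ge1}\frac{a_\lambda(n)}{n^s}:=\prod_{p\nmid\lambda(\lambda+1)}\frac{1}{1-a_\lambda(p)p^{-s}+p^{2-2s}},$$ the product over primes $p$ with $\mathrm{ord}_p(\lambda(\lambda+1))=0$, where for such $p\nmid 2N_\lambda$, $a_\lambda(p)=\gamma\,(b_\lambda(p)^2-2p)$ with $\gamma=\left(\frac{\lambda+1}{p}\right)$ the Legendre symbol. Thus $a_\lambda$ is multiplicative, $a_\lambda(p^m)=a_\lambda(p)a_\lambda(p^{m-1})-p^2a_\lambda(p^{m-2})$ for such $p$, and $a_\lambda(p^m)=0$ for $m\ge1$ if $p\mid\lambda(\lambda+1)$. *)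

(* Defs.v *)
From HB Require Import structures.
From mathcomp Require Import all_boot all_order all_fingroup all_algebra all_field.
From mathcomp Require Import all_classical all_reals all_analysis.
From mathcomp Require Import finmap complex.
Set Implicit Arguments.
Unset Strict Implicit.
Unset Printing Implicit Defensive.
Import Order.TTheory GRing.Theory Num.Theory.
Import numFieldNormedType.Exports.
Local Open Scope classical_set_scope.
Local Open Scope card_scope.
Local Open Scope ring_scope.

(* y^2 + a1 x y + a3 y = x^3 + a2 x^2 + a4 x + a6 *)
Record wcurve (K : Type) := WCurve { wa1 : K; wa2 : K; wa3 : K; wa4 : K; wa6 : K }.

HB.instance Definition _ (K : Type) := gen_eqMixin (wcurve K).
HB.instance Definition _ (K : Type) := gen_choiceMixin (wcurve K).

Definition map_wcurve (K L : Type) (f : K -> L) (W : wcurve K) : wcurve L :=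
  WCurve (f (wa1 W)) (f (wa2 W)) (f (wa3 W)) (f (wa4 W)) (f (wa6 W)).

Section Weierstrass.
Variables (K : fieldType) (W : wcurve K).
Local Notation a1 := (wa1 W).
Local Notation a2 := (wa2 W).
Local Notation a3 := (wa3 W).
Local Notation a4 := (wa4 W).
Local Notation a6 := (wa6 W).

Definition wb2 : K := a1 ^+ 2 + 4%:R * a2.
Definition wb4 : K := 2%:R * a4 + a1 * a3.
Definition wb6 : K := a3 ^+ 2 + 4%:R * a6.
Definition wb8 : K :=
  a1 ^+ 2 * a6 + 4%:R * a2 * a6 - a1 * a3 * a4 + a2 * a3 ^+ 2 - a4 ^+ 2.
Definition wc4 : K := wb2 ^+ 2 - 24%:R * wb4.
Definition wdisc : K :=
  - wb2 ^+ 2 * wb8 - 8%:R * wb4 ^+ 3 - 27%:R * wb6 ^+ 2 + 9%:R * wb2 * wb4 * wb6.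

(* the substitution x = u^2 x' + r, y = u^3 y' + u^2 s x' + t *)
Definition change_vars (u r s t : K) : wcurve K :=
  WCurve ((a1 + 2%:R * s) / u)
         ((a2 - s * a1 + 3%:R * r - s ^+ 2) / u ^+ 2)
         ((a3 + r * a1 + 2%:R * t) / u ^+ 3)
         ((a4 - s * a3 + 2%:R * r * a2 - (t + r * s) * a1 + 3%:R * r ^+ 2
           - 2%:R * s * t) / u ^+ 4)
         ((a6 + r * a4 + r ^+ 2 * a2 + r ^+ 3 - t * a3 - t ^+ 2 - r * t * a1)
           / u ^+ 6).

Definition on_affine_curve (P : K * K) : bool :=
  P.2 ^+ 2 + a1 * P.1 * P.2 + a3 * P.2
    == P.1 ^+ 3 + a2 * P.1 ^+ 2 + a4 * P.1 + a6.

(* [None] is the point at infinity. *)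
Definition on_curve (P : option (K * K)) : bool :=
  if P is Some Q then on_affine_curve Q else true.

Definition point_add (P Q : option (K * K)) : option (K * K) :=
  match P, Q with
  | None, _ => Q
  | _, None => P
  | Some (x1, y1), Some (x2, y2) =>
    if (x1 == x2) && (y1 + y2 + a1 * x2 + a3 == 0) then None else
    let m := if x1 == x2
      then (3%:R * x1 ^+ 2 + 2%:R * a2 * x1 + a4 - a1 * y1)
             / (2%:R * y1 + a1 * x1 + a3)
      else (y2 - y1) / (x2 - x1) in
    let x3 := m ^+ 2 + a1 * m - a2 - x1 - x2 in
    Some (x3, - (m + a1) * x3 - (y1 - m * x1) - a3)
  end.

Definition point_mul (n : nat) (P : option (K * K)) : option (K * K) :=
  iter n (point_add P) None.

End Weierstrass.

Section LocalAtP.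
Variable p : nat.

Definition p_integral (x : rat) : bool := ~~ (p %| `|denq x|)%N.

(* ord_p x = 0; false for x = 0 *)
Definition p_unit (x : rat) : bool := p_integral x && ~~ (p %| `|numq x|)%N.

Definition integral_model (W : wcurve rat) : bool :=
  [&& p_integral (wa1 W), p_integral (wa2 W), p_integral (wa3 W),
      p_integral (wa4 W) & p_integral (wa6 W)].

Definition isomorphic_model (W W' : wcurve rat) : Prop :=
  exists u r s t : rat, u != 0 /\ W' = change_vars W u r s t.

(* For an integral model of nonzero discriminant D, the exponent of p in the
   numerator of D is ord_p D. *)
Definition is_minimal_model (W W' : wcurve rat) : Prop :=
  [/\ isomorphic_model W W', integral_model W' &
    forall W'', isomorphic_model W W'' -> integral_model W'' ->
      (logn p `|numq (wdisc W')| <= logn p `|numq (wdisc W'')|)%N].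

Definition minimal_model (W : wcurve rat) : wcurve rat :=
  xget W [set W' | is_minimal_model W W'].

Definition good_reduction (W : wcurve rat) : bool :=
  p_unit (wdisc (minimal_model W)).

Definition multiplicative_reduction (W : wcurve rat) : bool :=
  ~~ good_reduction W && p_unit (wc4 (minimal_model W)).

(* On p-integral rationals [ratr] is reduction modulo p. *)
Definition reduction (W : wcurve rat) : wcurve 'F_p :=
  map_wcurve (fun x : rat => ratr x : 'F_p) (minimal_model W).

Definition card_reduction (W : wcurve rat) : nat :=
  (#|[pred P : 'F_p * 'F_p | on_affine_curve (reduction W) P]|).+1.

Definition frobenius_trace (W : wcurve rat) : int :=
  p%:Z + 1 - (card_reduction W)%:Z.

Definition legendre (x : rat) : int :=
  let z : 'F_p := ratr x in
  if z == 0 then 0 else if [exists y : 'F_p, y ^+ 2 == z] then 1 else -1.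

End LocalAtP.

Section Conductor.
Variables (p : nat) (L : splittingFieldType rat).

(* The normalized discrete valuation of a prime of L above p; the value of v
   at 0 is irrelevant. *)
Definition valuation_above (v : L -> int) : Prop :=
  [/\ forall x y : L, x != 0 -> y != 0 -> v (x * y) = v x + v y,
      forall x y : L, x != 0 -> y != 0 -> x + y != 0 ->
        Num.min (v x) (v y) <= v (x + y),
      exists2 x : L, x != 0 & v x = 1 &
      0 < v p%:R].

(* lower numbering *)
Definition ramification_group (v : L -> int) (i : nat) : {set gal_of {:L}} :=
  [set s : gal_of {:L} | `[< forall x : L, x != 0 -> 0 <= v x ->
     s x != x -> (i.+1)%:Z <= v (s x - x) >]]%SET.

Definition point_coords (T : seq (option (L * L))) : seq L :=
  flatten [seq (if P is Some Q then [:: Q.1; Q.2] else [::]) | P <- T].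

(* L = Q(W[l]), and T enumerates W[l]. *)
Definition torsion_field (W : wcurve rat) (l : nat) (T : seq (option (L * L))) : Prop :=
  let WL := map_wcurve (fun x : rat => ratr x : L) W in
  [/\ uniq T, size T = (l ^ 2)%N,
      forall P, (P \in T) = on_curve WL P && (point_mul WL l P == None) &
      agenv (1 + <<point_coords T>>)%VS = {:L}%VS].

Definition fixes_point (s : gal_of {:L}) (P : option (L * L)) : bool :=
  omap (fun Q => (s Q.1, s Q.2)) P == P.

(* dim_{F_l} (W[l] / W[l]^G), for T an enumeration of W[l] *)
Definition codim_fixed (l : nat) (T : seq (option (L * L)))
    (G : {set gal_of {:L}}) : nat :=
  (2 - logn l (count (fun P => [forall s in G, fixes_point s P]) T))%N.

End Conductor.

(* delta_p = \sum_(i >= 1) |G_i| / |G_0| * dim (W[l] / W[l]^(G_i)), with l <> p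
   prime and G_i the ramification groups of Q(W[l]) at a prime above p; it does
   not depend on the choices. The terms vanish as soon as G_i is trivial. *)
Definition is_wild_exponent (W : wcurve rat) (p : nat) (delta : rat) : Prop :=
  exists (l : nat) (L : splittingFieldType rat) (T : seq (option (L * L)))
         (v : L -> int) (m : nat),
  [/\ prime l /\ l != p, torsion_field W l T, valuation_above p v,
      #|ramification_group v m| = 1%N &
      delta = \sum_(1 <= i < m)
        (#|ramification_group v i|%:R / #|ramification_group v 0|%:R)
          * (codim_fixed l T (ramification_group v i))%:R].

Definition is_conductor_exponent (W : wcurve rat) (p f : nat) : Prop :=
  if good_reduction p W then f = 0%N
  else if multiplicative_reduction p W then f = 1%N
  else exists2 delta : rat, is_wild_exponent W p delta & f%:R = 2%:R + delta.

Definition is_conductor (W : wcurve rat) (N : nat) : Prop :=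
  (0 < N)%N /\ forall p, prime p -> is_conductor_exponent W p (logn p N).

Definition conductor (W : wcurve rat) : nat :=
  xget 1%N [set N | is_conductor W N].

(* y^2 = (x - 1) (x^2 - 1 / (lambda + 1)) *)
Definition Ecurve (lambda : rat) : wcurve rat :=
  WCurve 0 (-1) 0 (- (lambda + 1)^-1) (lambda + 1)^-1.

Definition blambda (lambda : rat) (p : nat) : int :=
  frobenius_trace p (Ecurve lambda).

(* The formula is only used at primes p with ord_p (lambda (lambda + 1)) = 0.
   Such p are automatically odd and of good reduction, so the Euler factor is
   always the intended one. *)
Definition alambda_prime (lambda : rat) (p : nat) : int :=
  legendre p (lambda + 1) * (blambda lambda p ^+ 2 - 2%:R * p%:Z).

(* coefficients of 1 / (1 - a X + p^2 X^2) *)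
Fixpoint euler_coeff (a : int) (p m : nat) : int :=
  match m with
  | 0 => 1
  | m1.+1 =>
    match m1 with
    | 0 => a
    | m2.+1 => a * euler_coeff a p m1 - p%:Z ^+ 2 * euler_coeff a p m2
    end
  end.

Definition alambda_prime_power (lambda : rat) (p m : nat) : int :=
  if p_unit p (lambda * (lambda + 1))
  then euler_coeff (alambda_prime lambda p) p m
  else (m == 0%N)%:R.

Definition alambda (lambda : rat) (n : nat) : int :=
  \prod_(p <- primes n) alambda_prime_power lambda p (logn p n).

Section DedekindZeta.
Variable K : fieldExtType rat.

Definition ring_of_integers : set K :=
  [set x : K | integralOver (intr : int -> K) x].

Definition is_nonzero_ideal (I : set K) : Prop :=
  [/\ I `<=` ring_of_integers,
      exists2 x, I x & x != 0,
      forall x y, I x -> I y -> I (x + y) &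
      forall c x, ring_of_integers c -> I x -> I (c * x)].

Definition cosets (I : set K) : set (set K) :=
  [set (fun y => x + y) @` I | x in ring_of_integers].

Definition ideals_of_norm (n : nat) : set (set K) :=
  [set I | is_nonzero_ideal I /\ cosets I #= `I_n].

(* [ideals_of_norm n] is finite for every n >= 1. *)
Definition dedekind_coeff (n : nat) : nat := #|` fset_set (ideals_of_norm n)|%N.

End DedekindZeta.

Section GRH.
Variable R : realType.
Local Notation C := (R[i]^o).

(* n^(-s) for n >= 1 *)
Definition nat_powN (n : nat) (s : C) : C :=
  Complex (expR (- complex.Re s * ln n%:R) * cos (complex.Im s * ln n%:R))
          (- (expR (- complex.Re s * ln n%:R) * sin (complex.Im s * ln n%:R))).

Definition dedekind_zeta_partial (K : fieldExtType rat) (s : C) : nat -> C :=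
  fun m => \sum_(0 <= n < m) (dedekind_coeff K n.+1)%:R * nat_powN n.+1 s.

(* Over the field of scalars C, [derivable Z s 1] is complex differentiability. *)
Definition is_dedekind_zeta (K : fieldExtType rat) (Z : C -> C) : Prop :=
  (forall s : C, s != 1 -> derivable Z s 1) /\
  (forall s : C, 1 < complex.Re s -> dedekind_zeta_partial K s @ \oo --> Z s).

Definition GRH : Prop :=
  forall (K : fieldExtType rat) (Z : C -> C), is_dedekind_zeta K Z ->
  forall s : C, 0 < complex.Re s < 1 -> Z s = 0 -> complex.Re s = 2%:R^-1.

End GRH.

(* Main.v *)
Require Import Defs.
From Stdlib Require Import ZArith.
From mathcomp Require Import all_boot all_order all_algebra.
From mathcomp Require Import all_reals.
From mathcomp Require Import zify ssrZ ring lra.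
Set Implicit Arguments.
Unset Strict Implicit.
Unset Printing Implicit Defensive.
Import Order.TTheory GRing.Theory Num.Theory.
Local Open Scope ring_scope.

(** The curve has the rational 2-torsion point [(1, 0)], so [b(p)], and hence
    [a = a(p)], is even at every odd prime [p] with a nontrivial Euler factor.
    Writing [U_m] for [a(p^m)], it follows that [U_m] is even for odd [m]. For
    even indices [U_(2j) = f g] with [f, g = U_j +- p U_(j-1)], and
    [(2p - a) f^2 + (2p + a) g^2 = 4 p^(2j+1)]; so if [|a| <= 2p] and
    [U_(2j) <> 0] then [p^j <= |f g| = |U_(2j)|], while for [|a| >= 2p] the
    sequence grows geometrically. Only finitely many triples [(p, a, j)] can
    therefore give [|a(p^(2j))| <= 97], and the odd integers of absolute value
    at most 97 that are products of the resulting values avoid the lists. *)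

(** * Parity of the affine point count in the presence of rational 2-torsion *)

(** The moved elements pair off as [x], [f x]; the induction removes one such pair at a time. *)
Lemma odd_card_involution (T : finType) (f : T -> T) (A : {set T}) :
  involutive f -> {in A, forall x, f x \in A} ->
  odd #|A| = odd #|[set x in A | f x == x]|.
Proof.
move=> fK; have [n] := ubnP #|A|; elim: n A => // n IH A leA stA.
have [/forall_inP fix_all|] := boolP [forall x in A, f x == x].
  congr (odd #|pred_of_set _|); apply/setP=> x; rewrite !inE.
  by case: (boolP (x \in A)) => // /fix_all ->.
rewrite negb_forall_in => /exists_inP[x xA fx_neq].
have fxA : f x \in A :\ x by rewrite !inE fx_neq stA.
have stB : {in A :\ x :\ f x, forall y, f y \in A :\ x :\ f x}.
  move=> y; rewrite !inE => /and3P[y1 y2 yA].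
  rewrite (inj_eq (inv_inj fK)) y2 stA // andbT.
  by apply: contra y1 => /eqP <-; rewrite fK.
have leB : (#|A :\ x :\ f x| < n)%N.
  by move: leA; rewrite (cardsD1 x A) xA (cardsD1 (f x) (A :\ x)) fxA; lia.
rewrite (cardsD1 x A) xA (cardsD1 (f x) (A :\ x)) fxA !add1n /= negbK IH //.
congr (odd #|pred_of_set _|); apply/setP=> y; rewrite !inE.
have [->|_] /= := eqVneq y (f x).
  by rewrite fK eq_sym (negPf fx_neq) andbF.
by have [->|_] /= := eqVneq y x; rewrite ?(negPf fx_neq) ?andbF.
Qed.

(** The 2-division polynomial: outside characteristic 2, its roots are the abscissas of the points
    of order 2. *)
Definition two_torsion_poly (K : fieldType) (W : wcurve K) (x : K) : K :=
  4%:R * x ^+ 3 + wb2 W * x ^+ 2 + 2%:R * wb4 W * x + wb6 W.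

Lemma two_torsion_polyE (K : fieldType) (W : wcurve K) (x y : K) :
  (2%:R * y + wa1 W * x + wa3 W) ^+ 2 - two_torsion_poly W x
  = 4%:R * (y ^+ 2 + wa1 W * x * y + wa3 W * y
            - (x ^+ 3 + wa2 W * x ^+ 2 + wa4 W * x + wa6 W)).
Proof. by rewrite /two_torsion_poly /wb2 /wb4 /wb6; ring. Qed.

(** The hypotheses encode the factorization [4 (x - e) (x^2 + u x + v)] of the 2-division
    polynomial. The factor 4 on the left lets [wb8] be eliminated through [4 b8 = b2 b6 - b4^2]. *)
Lemma wdisc_two_torsion (K : fieldType) (W : wcurve K) (e u v : K) :
  wb2 W = 4%:R * (u - e) -> wb4 W = 2%:R * (v - e * u) -> wb6 W = - 4%:R * e * v ->
  4%:R * wdisc W = 64%:R * (u ^+ 2 - 4%:R * v) * (e ^+ 2 + u * e + v) ^+ 2.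
Proof.
move=> E2 E4 E6.
have -> : 4%:R * wdisc W = - wb2 W ^+ 2 * (wb2 W * wb6 W - wb4 W ^+ 2)
  - 32%:R * wb4 W ^+ 3 - 108%:R * wb6 W ^+ 2 + 36%:R * wb2 W * wb4 W * wb6 W.
  by rewrite /wdisc /wb2 /wb4 /wb6 /wb8; ring.
by rewrite E2 E4 E6; ring.
Qed.

(** As the discriminant is nonzero, the quadratic cofactor [q] has no double root and does not
    vanish at [e]. So [x -> - u - x] swaps the roots of [q] without fixed points, and [e] is left
    over. *)
Lemma odd_card_two_torsion_roots (K : finFieldType) (W : wcurve K) (e : K) :
  2%:R != 0 :> K -> wdisc W != 0 -> two_torsion_poly W e = 0 ->
  odd #|[set x | two_torsion_poly W x == 0]|.
Proof.
move=> two0 disc0 root_e.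
have four0 : 4%:R != 0 :> K by rewrite (natrM _ 2 2) mulf_neq0.
pose u := wb2 W / 4%:R + e; pose v := wb4 W / 2%:R + e * u.
have E2 : wb2 W = 4%:R * (u - e) by rewrite /u; field.
have E4 : wb4 W = 2%:R * (v - e * u) by rewrite /v; field.
have E6 : wb6 W = - 4%:R * e * v.
  move: root_e; rewrite /two_torsion_poly E2 E4 => /eqP.
  by rewrite addrC addr_eq0 => /eqP ->; ring.
have := wdisc_two_torsion E2 E4 E6.
pose q x := x ^+ 2 + u * x + v => discE.
have [disc_q qe] : u ^+ 2 - 4%:R * v != 0 /\ q e != 0.
  apply/andP; rewrite -negb_or; apply: contra disc0 => h.
  rewrite -(mulrI_eq0 _ (mulfI four0)) discE.
  by case/orP: h; rewrite /q => /eqP ->; rewrite ?expr0n /= ?mulr0 ?mul0r.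
have fact x : two_torsion_poly W x = 4%:R * (x - e) * q x.
  by rewrite /two_torsion_poly E2 E4 E6 /q; ring.
have -> : [set x | two_torsion_poly W x == 0] = e |: [set x | q x == 0].
  by apply/setP=> x; rewrite !inE fact !mulf_eq0 (negPf four0) subr_eq0.
rewrite cardsU1 inE qe add1n /=.
rewrite (@odd_card_involution _ (fun x => - u - x)).
- rewrite (_ : [set x in _ | _] = set0) ?cards0 //.
  apply/setP=> x; rewrite !inE; apply/negP => /andP[/eqP qx /eqP ux].
  case/eqP: disc_q.
  have -> : u ^+ 2 - 4%:R * v = (x - (- u - x)) ^+ 2 - 4%:R * q x by rewrite /q; ring.
  by rewrite ux qx subrr expr0n mulr0 subr0.
- by move=> x; ring.
- by move=> x; rewrite !inE => /eqP <-; rewrite /q; apply/eqP; ring.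
Qed.

(** Negation on the curve is an involution fixing the points with [2 y + a1 x + a3 = 0], exactly one
    above each root of the 2-division polynomial. *)
Lemma odd_card_affine_points (K : finFieldType) (W : wcurve K) (e : K) :
  2%:R != 0 :> K -> wdisc W != 0 -> two_torsion_poly W e = 0 ->
  odd #|[pred P | on_affine_curve W P]|.
Proof.
move=> two0 disc0 root_e; rewrite -cardsE.
have four0 : 4%:R != 0 :> K by rewrite (natrM _ 2 2) mulf_neq0.
have onE (x y : K) : on_affine_curve W (x, y) =
    ((2%:R * y + wa1 W * x + wa3 W) ^+ 2 == two_torsion_poly W x).
  by rewrite -[RHS]subr_eq0 two_torsion_polyE mulf_eq0 (negPf four0) subr_eq0.
pose neg (P : K * K) := (P.1, - P.2 - wa1 W * P.1 - wa3 W).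
rewrite (@odd_card_involution _ neg).
- have := odd_card_two_torsion_roots two0 disc0 root_e.
  pose lift (x : K) := (x, - (wa1 W * x + wa3 W) / 2%:R).
  rewrite -(card_imset _ (_ : injective lift)); last by move=> x x' [].
  congr (odd #|pred_of_set _|); apply/setP=> -[x y].
  rewrite !inE onE xpair_eqE eqxx /=.
  apply/imsetP/andP=> [[x'] | [/eqP on_xy /eqP y_neg]].
    rewrite inE => /eqP root_x [-> ->]; rewrite root_x; split; last by apply/eqP; field.
    by rewrite sqrf_eq0; apply/eqP; field.
  have y0 : 2%:R * y + wa1 W * x + wa3 W = 0.
    have -> : 2%:R * y + wa1 W * x + wa3 W = y - (- y - wa1 W * x - wa3 W) by ring.
    by rewrite y_neg subrr.
  exists x; first by rewrite inE -on_xy y0 expr0n.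
  by rewrite /lift; congr (_, _); apply: (mulfI two0); rewrite -[LHS]subr0 -y0; field.
- by move=> [x y]; rewrite /neg /=; congr (_, _); ring.
- by move=> [x y]; rewrite !inE !onE => /eqP <-; apply/eqP; rewrite /=; ring.
Qed.

(** * Reduction of rationals modulo p *)

(** Any fraction with denominator prime to [p] may witness the reduction, not only the one in lowest
    terms, so compatibility with field operations is a direct computation. For prime [p], uniqueness
    of [z] is [reduces_to_inj]. *)
Definition reduces_to (p : nat) (x : rat) (z : 'F_p) : Prop :=
  exists a b : int, [/\ (b%:~R : 'F_p) != 0, x = a%:~R / b%:~R & z = a%:~R / b%:~R].

Arguments reduces_to : clear implicits.

Section Reduction.
Variables (p : nat) (p_prime : prime p).
Local Notation "x ~> z" := (reduces_to p x z) (at level 70).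

Lemma Fp_intr_eq0 (n : int) : ((n%:~R : 'F_p) == 0) = (p %| `|n|)%N.
Proof.
rewrite (dvdn_pcharf (pchar_Fp p_prime)); case: (intP n) => [|m|m] //.
by rewrite abszN mulrNz oppr_eq0.
Qed.

Lemma Fp_intr_neq0 (n : int) : (n%:~R : 'F_p) != 0 -> (n%:~R : rat) != 0.
Proof. by apply: contra; rewrite intr_eq0 => /eqP ->. Qed.

Lemma reduces_to_int (n : int) : n%:~R ~> n%:~R.
Proof. by exists n, 1; rewrite !divr1 oner_neq0. Qed.

Lemma reduces_to_nat (n : nat) : n%:R ~> n%:R.
Proof. exact: (reduces_to_int n). Qed.

Lemma reduces_toD x y z t : x ~> z -> y ~> t -> x + y ~> z + t.
Proof.
move=> [a [b [b0 -> ->]]] [c [d [d0 -> ->]]]; exists (a * d + c * b), (b * d).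
have [bq dq] := (Fp_intr_neq0 b0, Fp_intr_neq0 d0).
by rewrite !(intrD, intrM) mulf_neq0 //; split=> //; field; apply/andP.
Qed.

Lemma reduces_toM x y z t : x ~> z -> y ~> t -> x * y ~> z * t.
Proof.
move=> [a [b [b0 -> ->]]] [c [d [d0 -> ->]]]; exists (a * c), (b * d).
have [bq dq] := (Fp_intr_neq0 b0, Fp_intr_neq0 d0).
by rewrite !intrM mulf_neq0 //; split=> //; field; apply/andP.
Qed.

Lemma reduces_toN x z : x ~> z -> - x ~> - z.
Proof.
move=> [a [b [b0 -> ->]]]; exists (- a), b.
by rewrite !mulrNz !mulNr.
Qed.

Lemma reduces_toX x z n : x ~> z -> x ^+ n ~> z ^+ n.
Proof.
move=> xz; elim: n => [|n IH]; first exact: reduces_to_nat 1%N.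
by rewrite !exprS; apply: reduces_toM.
Qed.

Lemma reduces_toV x z : x ~> z -> z != 0 -> x^-1 ~> z^-1.
Proof.
move=> [a [b [b0 -> ->]]]; rewrite mulf_eq0 invr_eq0 (negPf b0) orbF => a0.
by exists b, a; rewrite !invf_div.
Qed.

Lemma reduces_to_inj x z t : x ~> z -> x ~> t -> z = t.
Proof.
move=> xz xt; have := reduces_toD xz (reduces_toN xt).
rewrite subrr => -[a [b [b0 /esym/eqP]]].
rewrite mulf_eq0 invr_eq0 (negPf (Fp_intr_neq0 b0)) orbF intr_eq0 => /eqP ->.
by rewrite mul0r => /eqP; rewrite subr_eq0 => /eqP.
Qed.

Lemma reduces_to_ratr x : p_integral p x -> x ~> ratr x.
Proof.
by move=> x_int; exists (numq x), (denq x); rewrite Fp_intr_eq0 divq_num_den.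
Qed.

(** In lowest terms [p] cannot divide both numerator and denominator. This is the tool for excluding
    poles at [p]. *)
Lemma reduces_to_invr0 x : ~~ p_integral p x -> x^-1 ~> 0.
Proof.
rewrite negbK => p_den; exists (denq x), (numq x); split.
- rewrite Fp_intr_eq0; apply/negP=> p_num; have := coprime_num_den x.
  move/eqP => gcd1; have : (p %| gcdn `|numq x| `|denq x|)%N by rewrite dvdn_gcd p_num.
  by rewrite gcd1 dvdn1 => /eqP p1; move: p_prime; rewrite p1.
- by rewrite -{1}[x]divq_num_den invf_div.
- by move: p_den; rewrite -Fp_intr_eq0 => /eqP ->; rewrite mul0r.
Qed.

(** Otherwise [1 = x * x^-1] would reduce to [z * 0 = 0]. *)
Lemma reduces_to_p_integral x z : x ~> z -> p_integral p x.
Proof.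
have [->|x_neq0 xz] := eqVneq x 0; first by rewrite /p_integral dvdn1 neq_ltn prime_gt1 ?orbT.
apply: contraT => /reduces_to_invr0 inv0.
have := reduces_to_inj (reduces_toM xz inv0).
rewrite divff // mulr0 => /(_ _ (reduces_to_nat 1)) /eqP.
by rewrite eq_sym oner_eq0.
Qed.

Lemma p_unitE x z : x ~> z -> p_unit p x = (z != 0).
Proof.
move=> xz; have x_int := reduces_to_p_integral xz.
rewrite /p_unit x_int (reduces_to_inj xz (reduces_to_ratr x_int)) /=.
rewrite mulf_eq0 invr_eq0 !Fp_intr_eq0.
by rewrite -[(p %| `|denq x|)%N]negbK -/(p_integral p x) x_int orbF.
Qed.

End Reduction.

Ltac reduce_ring_expr :=
  repeat match goal with
  | |- reduces_to _ (_ + _) _ => apply: reduces_toD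
  | |- reduces_to _ (- _) _ => apply: reduces_toN
  | |- reduces_to _ (_ * _) _ => apply: reduces_toM
  | |- reduces_to _ (_ ^+ _) _ => apply: reduces_toX
  | |- reduces_to _ (_%:R) _ => apply: reduces_to_nat
  | |- _ => assumption
  end.

(** * Integral and minimal Weierstrass models modulo p *)

Lemma reduces_to_wdisc (p : nat) (W : wcurve rat) : prime p -> integral_model p W ->
  reduces_to p (wdisc W) (wdisc (map_wcurve (fun x : rat => ratr x : 'F_p) W)).
Proof.
move=> p_prime /and5P[/(reduces_to_ratr p_prime) h1 /(reduces_to_ratr p_prime) h2
  /(reduces_to_ratr p_prime) h3 /(reduces_to_ratr p_prime) h4 /(reduces_to_ratr p_prime) h6].
rewrite /wdisc /wb2 /wb4 /wb6 /wb8 /=.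
by reduce_ring_expr.
Qed.

Lemma wdisc_change_vars (K : fieldType) (W : wcurve K) (u r s t : K) : u != 0 ->
  wdisc (change_vars W u r s t) = wdisc W / u ^+ 12.
Proof.
move=> u0; rewrite /wdisc /wb2 /wb4 /wb6 /wb8 /change_vars /=.
by field.
Qed.

Lemma two_torsion_poly_change_vars (K : fieldType) (W : wcurve K) (u r s t x : K) :
  u != 0 ->
  two_torsion_poly (change_vars W u r s t) ((x - r) / u ^+ 2)
    = two_torsion_poly W x / u ^+ 6.
Proof.
move=> u0; rewrite /two_torsion_poly /wb2 /wb4 /wb6 /change_vars /=.
by field.
Qed.

Lemma change_vars_id (K : fieldType) (W : wcurve K) : change_vars W 1 0 0 0 = W.
Proof.
case: W => a1 a2 a3 a4 a6; rewrite /change_vars /=.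
by rewrite !expr1n !divr1; congr WCurve; ring.
Qed.

Section GoodPrime.
Variables (p : nat) (p_prime : prime p).

(** [W] itself has discriminant of order 0, hence is minimal; so the choice in [minimal_model] does
    return a minimal model, whose discriminant has order at most 0. *)
Lemma minimal_model_unit_disc (W : wcurve rat) :
  integral_model p W -> p_unit p (wdisc W) ->
  [/\ isomorphic_model W (minimal_model p W), integral_model p (minimal_model p W) &
      p_unit p (wdisc (minimal_model p W))].
Proof.
move=> W_int /andP[_ W_disc].
have W_logn : logn p `|numq (wdisc W)| = 0%N by rewrite lognE (negPf W_disc) !andbF.
have W_iso : isomorphic_model W W.
  by exists 1, 0, 0, 0; rewrite oner_neq0 change_vars_id.
have : is_minimal_model p W W by split=> // W'' _ _; rewrite W_logn.
move=> /(classical_sets.xgetI W); rewrite -/(minimal_model p W) => -[iso int /(_ W W_iso W_int) le_disc].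
split=> //; rewrite /p_unit (reduces_to_p_integral p_prime (reduces_to_wdisc p_prime int)) /=.
move: le_disc; rewrite W_logn leqn0 lognE p_prime /=.
(* [logn p 0] is 0, so a zero discriminant must be excluded: a change of variables only divides it
   by [u ^+ 12]. *)
case: ifP => // /negbT; rewrite negb_and => /orP[|//].
case: iso => u [r [s [t [u0 ->]]]]; rewrite absz_gt0 numq_eq0 wdisc_change_vars //.
rewrite mulf_eq0 invr_eq0 expf_eq0 (negPf u0) /= orbF negbK => /eqP disc0.
by move: W_disc; rewrite disc0 dvdn0.
Qed.

Lemma two_torsion_poly_reduction (W : wcurve rat) (e : rat) :
  odd p -> integral_model p W -> two_torsion_poly W e = 0 ->
  two_torsion_poly (map_wcurve (fun x : rat => ratr x : 'F_p) W) (ratr e) = 0.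
Proof.
move=> p_odd W_int root_e.
case/and5P: (W_int) => /(reduces_to_ratr p_prime) h1 /(reduces_to_ratr p_prime) h2
  /(reduces_to_ratr p_prime) h3 /(reduces_to_ratr p_prime) h4 /(reduces_to_ratr p_prime) h6.
set V := map_wcurve _ W.
have r2 : reduces_to p (wb2 W) (wb2 V) by rewrite /wb2; reduce_ring_expr.
have r4 : reduces_to p (wb4 W) (wb4 V) by rewrite /wb4; reduce_ring_expr.
have r6 : reduces_to p (wb6 W) (wb6 V) by rewrite /wb6; reduce_ring_expr.
have red (x : rat) z : reduces_to p x z -> reduces_to p (two_torsion_poly W x) (two_torsion_poly V z).
  move=> xz; rewrite /two_torsion_poly.
  by reduce_ring_expr.
have [e_int|e_nint] := boolP (p_integral p e).
  have := red _ _ (reduces_to_ratr p_prime e_int); rewrite root_e => red0.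
  exact: (reduces_to_inj red0 (reduces_to_nat _ 0)).
have e_inv := reduces_to_invr0 p_prime e_nint.
have e0 : e != 0.
  by apply: contraNneq e_nint => ->; rewrite /p_integral dvdn1 neq_ltn prime_gt1 ?orbT.
(* If [e] had a pole at [p], dividing the equation by [e ^+ 3] and reducing would leave [4 = 0] in
   ['F_p], impossible for odd [p]. *)
have : reduces_to p (4%:R + (wb2 W * e^-1 + 2%:R * wb4 W * e^-1 ^+ 2 + wb6 W * e^-1 ^+ 3))
   (4%:R + (wb2 V * 0 + 2%:R * wb4 V * 0 ^+ 2 + wb6 V * 0 ^+ 3)).
  by reduce_ring_expr.
have -> : 4%:R + (wb2 W * e^-1 + 2%:R * wb4 W * e^-1 ^+ 2 + wb6 W * e^-1 ^+ 3)
   = two_torsion_poly W e / e ^+ 3 by rewrite /two_torsion_poly; field.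
rewrite root_e mul0r !expr0n !mulr0 !addr0 => red4.
have /eqP := reduces_to_inj red4 (reduces_to_nat _ 0).
rewrite -(dvdn_pcharf (pchar_Fp p_prime)) (@Euclid_dvdX 2 2 p) // andbT.
by rewrite dvdn_prime2 // => /eqP p2; exfalso; move: p_odd; rewrite p2.
Qed.

End GoodPrime.

(** * Good reduction of the curve and evenness of a(p) *)

Lemma Ecurve_model (p : nat) (lambda : rat) : prime p -> odd p ->
  p_unit p (lambda * (lambda + 1)) ->
  integral_model p (Ecurve lambda) /\ p_unit p (wdisc (Ecurve lambda)).
Proof.
move=> p_prime p_odd w_unit.
have w_int : p_integral p (lambda * (lambda + 1)) by case/andP: w_unit.
have redw := reduces_to_ratr p_prime w_int.
have one_int : reduces_to p 1 1 := reduces_to_nat _ 1.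
have l_int : p_integral p lambda.
  apply: contraT => l_nint; have inv := reduces_to_invr0 p_prime l_nint.
  have l0 : lambda != 0.
    by apply: contraNneq l_nint => ->; rewrite /p_integral dvdn1 neq_ltn prime_gt1 ?orbT.
  have red1 := reduces_toD one_int inv.
  (* For [lambda] with a pole at [p], the product below would reduce to 0, yet it equals
     [1 + lambda^-1], which reduces to 1. *)
  have := reduces_toM redw (reduces_toX 2 inv).
  have -> : lambda * (lambda + 1) * lambda^-1 ^+ 2 = 1 + lambda^-1 by field.
  move/(reduces_to_inj red1)/eqP.
  by rewrite expr0n mulr0 addr0 oner_eq0.
have redl := reduces_to_ratr p_prime l_int; set l := ratr lambda in redl.
have redl1 := reduces_toD redl one_int.
have := p_unitE p_prime (reduces_toM redl redl1).
rewrite w_unit => /esym; rewrite mulf_eq0 negb_or => /andP[l0 l10].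
have redc := reduces_toV redl1 l10.
have l1q : lambda + 1 != 0.
  apply: contraNneq l10 => l1q; rewrite l1q in redl1.
  by apply/eqP; apply: (reduces_to_inj redl1 (reduces_to_nat _ 0)).
split.
  apply/and5P; split; apply: (reduces_to_p_integral p_prime).
  - exact: (reduces_to_nat _ 0).
  - exact: (reduces_toN one_int).
  - exact: (reduces_to_nat _ 0).
  - exact: (reduces_toN redc).
  - exact: redc.
have -> : wdisc (Ecurve lambda) = 64%:R * (lambda + 1)^-1 * (lambda * (lambda + 1)^-1) ^+ 2.
  by rewrite /wdisc /wb2 /wb4 /wb6 /wb8 /=; field.
rewrite (@p_unitE _ p_prime _ (64%:R * (l + 1)^-1 * (l * (l + 1)^-1) ^+ 2)).
  apply: mulf_neq0; last by rewrite expf_neq0 // mulf_neq0 // invr_neq0.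
  apply: mulf_neq0; last exact: invr_neq0.
  rewrite -(dvdn_pcharf (pchar_Fp p_prime)) (@Euclid_dvdX 2 6 p) // andbT dvdn_prime2 //.
  by apply: contraTneq p_odd => ->.
by reduce_ring_expr.
Qed.

Lemma odd_card_affine_reduction (p : nat) (lambda : rat) : prime p -> odd p ->
  p_unit p (lambda * (lambda + 1)) ->
  odd #|[pred P | on_affine_curve (reduction p (Ecurve lambda)) P]|.
Proof.
move=> p_prime p_odd w_unit.
have [E_int E_disc] := Ecurve_model p_prime p_odd w_unit.
have [[u [r [s [t [u0 Emin]]]]] min_int min_disc] := minimal_model_unit_disc p_prime E_int E_disc.
(* The abscissa of the 2-torsion point [(1, 0)], carried to the minimal model. *)
apply: (@odd_card_affine_points _ _ (ratr ((1 - r) / u ^+ 2))).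
- rewrite -(dvdn_pcharf (pchar_Fp p_prime)) dvdn_prime2 //.
  by apply: contraTneq p_odd => ->.
- by rewrite -(p_unitE p_prime (reduces_to_wdisc p_prime min_int)).
- apply: two_torsion_poly_reduction => //.
  rewrite Emin two_torsion_poly_change_vars // /two_torsion_poly /wb2 /wb4 /wb6 /=.
  by apply/eqP; rewrite mulf_eq0; apply/orP; left; apply/eqP; ring.
Qed.

(** With [c] affine points, the point at infinity makes the trace [p - c], a difference of odd
    numbers; so [b^2 - 2p] is even. *)
Lemma alambda_prime_even (p : nat) (lambda : rat) : prime p -> odd p ->
  p_unit p (lambda * (lambda + 1)) -> ~~ odd `|alambda_prime lambda p|.
Proof.
move=> p_prime p_odd w_unit.
have := odd_card_affine_reduction p_prime p_odd w_unit.
rewrite /alambda_prime /blambda /frobenius_trace /card_reduction.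
move: #|_| => c c_odd; rewrite abszM oddM negb_and; apply/orP; right.
have -> : p%:Z + 1 - c.+1%:Z = p%:Z - c%:Z by lia.
move: p_odd c_odd; rewrite expr2; lia.
Qed.

(** * Identities and lower bounds for the coefficients at prime powers *)

Lemma euler_coeffSS (a : int) (p m : nat) :
  euler_coeff a p m.+2 = a * euler_coeff a p m.+1 - p%:Z ^+ 2 * euler_coeff a p m.
Proof. by []. Qed.

(** If [A], [B] are the roots of [X^2 - a X + p^2], then [U_(m+1) - A U_m = B^(m+1)] and
    symmetrically; the identity is the product of the two. *)
Lemma euler_coeff_norm (a : int) (p m : nat) :
  euler_coeff a p m.+1 ^+ 2 - a * euler_coeff a p m.+1 * euler_coeff a p m
    + p%:Z ^+ 2 * euler_coeff a p m ^+ 2 = p%:Z ^+ (2 * m.+1).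
Proof.
elim: m => [|m IH]; first by rewrite /=; ring.
by rewrite [(2 * m.+2)%N]mulnS exprD -IH euler_coeffSS; ring.
Qed.

(** The duplication formulas of Lucas sequences: the first gives evenness at odd indices, the second
    the factorization at even indices. The recurrence interleaves them, so they are proved
    together. *)
Lemma euler_coeff_double (a : int) (p m : nat) :
  euler_coeff a p m.*2.+1
    = euler_coeff a p m * (2%:R * euler_coeff a p m.+1 - a * euler_coeff a p m) /\
  euler_coeff a p m.*2.+2
    = euler_coeff a p m.+1 ^+ 2 - p%:Z ^+ 2 * euler_coeff a p m ^+ 2.
Proof.
elim: m => [|m [IH1 IH2]]; first by split; rewrite /=; ring.
have E3 : euler_coeff a p m.*2.+3
  = euler_coeff a p m.+1 * (2%:R * euler_coeff a p m.+2 - a * euler_coeff a p m.+1).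
  by rewrite euler_coeffSS IH1 IH2 euler_coeffSS; ring.
by split; rewrite doubleS // euler_coeffSS E3 IH2 (euler_coeffSS _ _ m); ring.
Qed.

(** Each step multiplies the absolute value by at least [s = |a| - p]: since [p <= s], induction
    gives [p |U_k| <= |U_(k+1)|], so the subtracted term [p^2 |U_k|] costs at most [p |U_(k+1)|]. *)
Lemma euler_coeff_growth (a : int) (p m : nat) : 2%:R * p%:Z <= `|a| ->
  (`|a| - p%:Z) ^+ m <= `|euler_coeff a p m|.
Proof.
move=> a_ge; set s := `|a| - p%:Z; have s_ge : p%:Z <= s by rewrite /s; lra.
have p_ge0 : 0 <= p%:Z by [].
have step k : s * `|euler_coeff a p k| <= `|euler_coeff a p k.+1|.
  elim: k => [|k IH]; first by rewrite /= normr1 mulr1 /s; lra.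
  rewrite euler_coeffSS.
  apply: le_trans (lerB_dist _ _); rewrite !normrM (ger0_norm p_ge0).
  rewrite {1}/s mulrBl lerD2l lerN2 -mulrA ler_wpM2l //.
  by apply: le_trans IH; rewrite ler_wpM2r.
elim: m => [|m IH]; first by rewrite /= normr1.
by rewrite exprS; apply: le_trans (step m); rewrite ler_wpM2l // (le_trans p_ge0).
Qed.

(* With [f, g = U_j +- p U_(j-1)] one has [U_(2j) = f g], while the norm equation
   becomes [(2p - a) f^2 + (2p + a) g^2 = 4 p^(2j+1)]. *)
Lemma euler_coeff_even_ge (a : int) (p j : nat) : (0 < p)%N ->
  euler_coeff a p j.*2 != 0 -> p%:Z ^+ j <= `|euler_coeff a p j.*2|.
Proof.
move=> p_gt0; case: j => [|j] U_neq0; first by rewrite /= normr1.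
have [a_ge|a_lt] := leP (2%:R * p%:Z) `|a|.
  apply: le_trans (euler_coeff_growth _ a_ge).
  have p_ge1 : 1 <= p%:Z by lia.
  have s_ge : p%:Z <= `|a| - p%:Z by lra.
  apply: (@le_trans _ _ (p%:Z ^+ j.+1.*2)); first by rewrite ler_weXn2l //; lia.
  by rewrite lerXn2r // nnegrE (le_trans _ s_ge).
have [_ dbl] := euler_coeff_double a p j.
move: U_neq0 (euler_coeff_norm a p j); rewrite doubleS dbl.
set x := euler_coeff a p j.+1; set y := euler_coeff a p j => U_neq0 nrm.
pose f := x + p%:Z * y; pose g := x - p%:Z * y.
have Efg : x ^+ 2 - p%:Z ^+ 2 * y ^+ 2 = f * g by rewrite /f /g; ring.
rewrite Efg in U_neq0 *.
have : (2%:R * p%:Z - a) * f ^+ 2 + (2%:R * p%:Z + a) * g ^+ 2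
  = 4%:R * p%:Z * p%:Z ^+ (2 * j.+1) by rewrite -nrm /f /g; ring.
move: U_neq0; rewrite mulf_eq0 negb_or => /andP[f0 g0].
have f2 : 1 <= f ^+ 2 by rewrite -gtz0_ge1 exprn_even_gt0.
have g2 : 1 <= g ^+ 2 by rewrite -gtz0_ge1 exprn_even_gt0.
move=> E.
(* The weights [2p - a] and [2p + a] are positive with sum [4p], and [f^2, g^2 >= 1]; so the
   weighted sum is at most [4p f^2 g^2]. *)
have le_sq : p%:Z ^+ (2 * j.+1) <= `|f * g| ^+ 2.
  rewrite real_normK ?num_real // exprMn.
  have p0 : 0 < p%:Z by [].
  move: a_lt; rewrite ltr_norml => /andP[a1 a2].
  have : 4%:R * p%:Z * p%:Z ^+ (2 * j.+1) <= 4%:R * p%:Z * (f ^+ 2 * g ^+ 2).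
    rewrite -E (_ : 4%:R * p%:Z = 2%:R * p%:Z - a + (2%:R * p%:Z + a)); last by ring.
    rewrite [leRHS]mulrDl lerD // ler_wpM2l ?ler_peMr ?ler_peMl ?sqr_ge0 //; lra.
  by rewrite ler_pM2l // mulr_gt0.
by move: le_sq; rewrite mulnC exprM ler_sqr ?nnegrE ?exprn_ge0.
Qed.

(** * Finite verification for small values *)

(* The odd products, of absolute value at most 97, of one or more values
   [euler_coeff a p j.*2] with [p] an odd prime, [a] even and [0 < j]. *)
Definition small_odd_values : seq int :=
  [:: -95; -93; -91; -85; -81; -79; -77; -75; -73; -69; -63; -61; -57; -55; -49; -45;
      -37; -35; -33; -25; -21; -13; -11; -9; -5; 7; 11; 15; 23; 25; 27; 35; 39; 45; 47;
      49; 51; 55; 59; 63; 65; 75; 77; 81; 83; 87; 91; 95].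

(** A multiplicatively closed condition: an even factor makes the product even, and a large odd
    factor stays large when multiplied by an odd one. *)
Definition admissible (x : int) : bool :=
  [|| ~~ odd `|x|, (97 < `|x|)%N | x \in small_odd_values].

Lemma admissibleM (x y : int) : admissible x -> admissible y -> admissible (x * y).
Proof.
have closed : all (fun x : int => all (fun y : int => (97 < `|(x * y)%R|)%N || (x * y \in small_odd_values))
  small_odd_values) small_odd_values by vm_compute.
rewrite /admissible !abszM oddM negb_and; move: small_odd_values closed => T closed.
case: (boolP (odd `|x|)) => //= x_odd; case: (boolP (odd `|y|)) => //= y_odd.
case/orP=> [x_big _|xT].
  by rewrite (leq_trans x_big) // leq_pmulr // odd_gt0.
case/orP=> [y_big|yT].
  by rewrite (leq_trans y_big) // leq_pmull // odd_gt0.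
by have /allP/(_ y yT) := allP closed x xT; rewrite abszM.
Qed.

(* Evaluates [euler_coeff] in binary; [int] is unary. *)
Fixpoint Z_euler_coeff (a p : Z) (m : nat) : Z :=
  match m with
  | O => Z.one
  | S m1 =>
    match m1 with
    | O => a
    | S m2 => Z.sub (Z.mul a (Z_euler_coeff a p m1)) (Z.mul (Z.mul p p) (Z_euler_coeff a p m2))
    end
  end.

Lemma euler_coeff_Z (a : Z) (p m : nat) :
  euler_coeff (int_of_Z a) p m = int_of_Z (Z_euler_coeff a (Z.of_nat p) m).
Proof.
suff [] : euler_coeff (int_of_Z a) p m = int_of_Z (Z_euler_coeff a (Z.of_nat p) m) /\
  euler_coeff (int_of_Z a) p m.+1 = int_of_Z (Z_euler_coeff a (Z.of_nat p) m.+1) by [].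
elim: m => [|m [IH1 IH2]] //; split=> //; rewrite euler_coeffSS IH1 IH2 expr2.
rewrite [RHS](_ : _ = int_of_Z (a * Z_euler_coeff a (Z.of_nat p) m.+1
  - Z.of_nat p * Z.of_nat p * Z_euler_coeff a (Z.of_nat p) m)) //.
have Ep : int_of_Z (Z.of_nat p) = p%:Z := Z_of_intK (Posz p).
by rewrite rmorphB !rmorphM /= Ep.
Qed.

(** Size is tested in binary first, so that only integers of absolute value at most 97 are converted
    to unary. *)
Definition Z_admissible (x : Z) : bool :=
  if Z.leb (Z.abs x) (Z.of_nat 97) then admissible (int_of_Z x) else true.

(** The search box: [3 <= p <= 97], [1 <= j <= 4], and [a = 2 t] with [|t| <= 97]. For [j >= 2] only
    [p <= 9] occurs, because [p^j <= 97]. *)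
Lemma small_values_check :
  all (fun p => if prime p then
    all (fun j => if (j == 1)%N || (p <= 9)%N then
      all (fun t => Z_admissible (Z_euler_coeff (Z.add t t) (Z.of_nat p) j.*2) : bool)
        [seq Z.sub (Z.of_nat i) (Z.of_nat 97) | i <- iota 0 195]
      else true) (iota 1 4) else true) (iota 3 95).
Proof. by vm_compute. Qed.

Lemma admissible_even (x : int) : ~~ odd `|x| -> admissible x.
Proof. by rewrite /admissible => ->. Qed.

Lemma admissible_large (x : int) : (97 < `|x|)%N -> admissible x.
Proof. by rewrite /admissible => ->; rewrite orbT. Qed.

Lemma euler_coeff_admissible (a : int) (p m : nat) : prime p -> odd p ->
  ~~ odd `|a| -> (0 < m)%N -> admissible (euler_coeff a p m).
Proof.
move=> p_prime p_odd a_even m_gt0.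
have [m_odd|m_even] := boolP (odd m).
  apply: admissible_even; rewrite -[m]odd_double_half m_odd add1n.
  have [-> _] := euler_coeff_double a p m./2.
  rewrite abszM oddM negb_and; apply/orP; right.
  have : ~~ odd `|a * euler_coeff a p m./2| by rewrite abszM oddM (negPf a_even).
  by move: (a * _) (euler_coeff _ _ _.+1) => u v; lia.
rewrite -[m]odd_double_half (negPf m_even) add0n in m_gt0 *.
move: m./2 m_gt0 => j; rewrite double_gt0 => j_gt0.
have [U_odd|] := boolP (odd `|euler_coeff a p j.*2|); last exact: admissible_even.
have [U_le|] := leqP `|euler_coeff a p j.*2| 97; last exact: admissible_large.
have U_neq0 : euler_coeff a p j.*2 != 0 by apply: contraTneq U_odd => ->.
have p_ge3 : (2 < p)%N by move: (prime_gt1 p_prime) p_odd; lia.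
have pj_le : (p ^ j <= 97)%N.
  have := euler_coeff_even_ge (prime_gt0 p_prime) U_neq0.
  by rewrite -[p%:Z]natz -natrX natz; lia.
have p_le : (p <= 97)%N by apply: leq_trans pj_le; rewrite -{1}[p]expn1 leq_pexp2l //; lia.
(* Already [3^5 = 243] exceeds 97. *)
have j_le : (j <= 4)%N.
  rewrite leqNgt; apply/negP=> j_ge; have : (3 ^ 5 <= p ^ j)%N.
    by apply: (@leq_trans (p ^ 5)); [rewrite leq_exp2r | rewrite leq_pexp2l //; lia].
  by move=> h; have := leq_trans h pj_le.
have pj_small : (j == 1)%N || (p <= 9)%N.
  case: eqP => //= j_neq1; have : (p ^ 2 <= 97)%N.
    by apply: leq_trans pj_le; rewrite leq_pexp2l //; lia.
  by rewrite expnS expn1; nia.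
(* Either [|a| < 2p <= 194], or the growth bound gives [|a| - p <= 97], again with [p <= 97]. *)
have a_le : (`|a| <= 194)%N.
  have [a_ge|a_lt] := leP (2%:R * p%:Z) `|a|; last by lia.
  have := euler_coeff_growth j.*2 a_ge.
  have s_ge1 : 1 <= `|a| - p%:Z by lia.
  have := ler_weXn2l s_ge1 (_ : (1 <= j.*2)%N); rewrite expr1 double_gt0 => /(_ j_gt0).
  by lia.
have := allP small_values_check p; rewrite mem_iota p_prime => /(_ ltac:(lia)) check_p.
have := allP check_p j; rewrite mem_iota pj_small => /(_ ltac:(lia)) check_j.
have [t Et] : exists t : int, a = t + t by exists (a %/ 2)%Z; lia.
have := allP check_j (Z_of_int t).
have -> : Z.add (Z_of_int t) (Z_of_int t) = Z_of_int a by rewrite Et; lia.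
have EU := euler_coeff_Z (Z_of_int a) p j.*2; rewrite Z_of_intK in EU.
have -> : Z_admissible (Z_euler_coeff (Z_of_int a) (Z.of_nat p) j.*2)
    = admissible (euler_coeff a p j.*2).
  rewrite /Z_admissible -EU ifT //.
  by move: U_le; rewrite EU; move: (Z_euler_coeff _ _ _) => u; lia.
(* The check lists [t] as [i - 97], so [t] sits at index [t + 97]. *)
apply; apply/mapP; exists (Z.to_nat (Z.add (Z_of_int t) (Z.of_nat 97))).
  by rewrite mem_iota; lia.
by lia.
Qed.

(** * Products over the prime factors, and the excluded values *)

(** Nonemptiness matters: the empty product 1 is not admissible. *)
Lemma admissible_prod (I : eqType) (r : seq I) (F : I -> int) : (0 < size r)%N ->
  {in r, forall i, admissible (F i)} -> admissible (\prod_(i <- r) F i).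
Proof.
elim: r => // i [|j r] IH _ F_adm; first by rewrite big_seq1 F_adm ?mem_head.
rewrite big_cons; apply: admissibleM; first by rewrite F_adm ?mem_head.
by apply: IH => // k k_r; rewrite F_adm // in_cons k_r orbT.
Qed.

Lemma alambda_admissible (lambda : rat) (n : nat) :
  (1 < n)%N -> odd n -> admissible (alambda lambda n).
Proof.
move=> n_gt1 n_odd; apply: admissible_prod => [|p].
  by rewrite lt0n size_eq0 primes_eq0 -ltnNge.
rewrite mem_primes => /and3P[p_prime n_gt0 p_dvd].
have p_odd : odd p := dvdn_odd p_dvd n_odd.
have m_gt0 : (0 < logn p n)%N by rewrite logn_gt0 mem_primes p_prime n_gt0.
rewrite /alambda_prime_power; case: ifP => [w_unit|_].
  by apply: euler_coeff_admissible => //; apply: alambda_prime_even.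
(* A trivial Euler factor contributes 0, which is even. *)
by apply: admissible_even; rewrite eqn0Ngt m_gt0.
Qed.

Theorem theorem1p3 :
  (forall (lambda : rat) (n : nat),
     lambda != 0 -> lambda != -1 -> (1 < n)%N ->
     coprime n (2 * conductor (Ecurve lambda)) ->
     alambda lambda n \notin
       [:: 1; -1; 3; -3; 5; -7; -15; 17; -17; 19; -19; 21; -23; -27; -29;
           31; -31; 33; 37; -39; -51; 57; 69; -87]) /\
  (forall R : realType, GRH R ->
   forall (lambda : rat) (n : nat),
     lambda != 0 -> lambda != -1 -> (1 < n)%N ->
     coprime n (2 * conductor (Ecurve lambda)) ->
     alambda lambda n \notin
       [:: -41; 43; -43; -47; -53; -59; 67; -67; 71; -71; 79; -83; -89;
           97; -97]).
Proof.
split=> [lambda n _ _ n_gt1|R _ lambda n _ _ n_gt1]; rewrite coprimeMr coprimen2;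
  case/andP=> /(alambda_admissible lambda n_gt1) + _; apply: contraL;
  (* Every entry of either list is odd, at most 97 in absolute value and outside
     [small_odd_values]. *)
  by move: (alambda lambda n); apply/allP; vm_compute.
Qed.
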